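(* Let $\lambda=(\lambda_1,\ldots,\lambda_n)$ be a vector of positive integers with $\lambda_1=\lambda_2=\cdots=\lambda_n$. Let $\prec$ be the lexicographic term order on $\mathbb{K}[x_{ij}:1\le i\le n,\ 0\le j\le\lambda_i]$ such that $x_{ij}\succ x_{kl}$ if $j<l$, or $j=l$ and $i<k$. Then $\prec$ is delightful for $I_\lambda$, the toric ideal of the rational normal scroll $S(\lambda)$.
   Context: $\mathbb{K}$ is a field. The rational normal scroll $S(\lambda)$ is the toric variety with parametrization $x_{ij}=s^jt_i$ for $i=1,\ldots,n$, $j=0,\ldots,\lambda_i$; the toric ideal $I_\lambda$ is the kernel of the $\mathbb{K}$-algebra map from the polynomial ring $\mathbb{K}[x_{ij}:1\le i\le n,\,0\le j\le\lambda_i]$ to $\mathbb{K}[s,t_1,\ldots,t_n]$ sending $x_{ij}\mapsto s^jt_i$. Secants: for an ideal $I$ in a polynomial ring $\mathbb{K}[\mathbf{x}]=\mathbb{K}[x_1,\ldots,x_N]$ and $r\ge1$, with new variables $\mathbf{y}_j=(y_{j1},\ldots,y_{jN})$, $j=1,\ldots,r$, and $I(\mathbf{y}_j)$ the image of $I$ under $\mathbf{x}\mapsto\mathbf{y}_j$, set $$I^{\{r\}}=\Bigl(I(\mathbf{y}_1)+\cdots+I(\mathbf{y}_r)+\langle y_{1i}+\cdots+y_{ri}-x_i : 1\le i\le N\rangle\Bigr)\cap\mathbb{K}[\mathbf{x}].$$ A term order $\prec$ is delightful for $I$ if $\mathrm{in}_\prec(I^{\{r\}})=(\mathrm{in}_\prec(I))^{\{r\}}$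 for all integers $r\ge2$. *)

(* Defs.v *)
From HB Require Import structures.
From mathcomp Require Import all_boot all_order all_algebra.
From mathcomp Require Import mpoly.

Set Implicit Arguments.
Unset Strict Implicit.
Unset Printing Implicit Defensive.

Import GRing.Theory.
Local Open Scope ring_scope.

(* Ideals of a polynomial ring are Prop-valued predicates: membership in the
   ideals below is defined by existential statements over all polynomials. *)
Definition ideal_gen (K : fieldType) (N : nat)
    (S : {mpoly K[N]} -> Prop) (p : {mpoly K[N]}) : Prop :=
  exists s : seq ({mpoly K[N]} * {mpoly K[N]}),
    (forall c, c \in s -> S c.2) /\ p = \sum_(c <- s) c.1 * c.2.

Section Secants.
Variables (K : fieldType) (N : nat).

(* The ring K[x, y_1, ..., y_r] is {mpoly K[N + r * N]}: the first N
   variables are the x_i, the remaining r * N are the y_{ji}. *)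
Definition xvar (r : nat) (i : 'I_N) : {mpoly K[N + r * N]} :=
  'X_(lshift (r * N) i).

Definition yvar (r : nat) (j : 'I_r) (i : 'I_N) : {mpoly K[N + r * N]} :=
  'X_(rshift N (mxvec_index j i)).

Definition secant (r : nat) (I : {mpoly K[N]} -> Prop) (p : {mpoly K[N]})
    : Prop :=
  ideal_gen
    (fun q : {mpoly K[N + r * N]} =>
       (exists j : 'I_r, exists2 f, I f & q = f \mPo [tuple yvar j i | i < N])
       \/ (exists i : 'I_N, q = \sum_(j < r) yvar j i - xvar r i))
    (p \mPo [tuple xvar r i | i < N]).

End Secants.

(* Term orders on the monomials 'X_[m], m : 'X_{1..N}; tle le m1 m2 means that
   'X_[m1] precedes or equals 'X_[m2]. *)
Record termOrder (N : nat) := TermOrder {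
  tle :> rel 'X_{1..N};
  tle_anti : antisymmetric tle;
  tle_trans : transitive tle;
  tle_total : total tle;
  tle0m : forall m, tle 0%MM m;
  tle_add2r : forall m m1 m2, tle m1 m2 -> tle (m1 + m)%MM (m2 + m)%MM
}.

Section InitialIdeals.
Variables (K : fieldType) (N : nat) (le : termOrder N).

Definition is_lead_mon (f : {mpoly K[N]}) (m : 'X_{1..N}) : Prop :=
  m \in msupp f /\ forall m', m' \in msupp f -> le m' m.

Definition initial_ideal (I : {mpoly K[N]} -> Prop) : {mpoly K[N]} -> Prop :=
  ideal_gen (fun q => exists f m, [/\ I f, is_lead_mon f m & q = 'X_[m]]).

Definition delightful (I : {mpoly K[N]} -> Prop) : Prop :=
  forall r : nat, (2 <= r)%N -> forall p : {mpoly K[N]},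
    initial_ideal (secant r I) p <-> secant r (initial_ideal I) p.

End InitialIdeals.

(* The lexicographic order attached to a strict total order on the variables;
   gt v w means that variable v is larger than variable w. *)
Section Lex.
Variables (N : nat) (gt : rel 'I_N).

Definition lex_lt (m1 m2 : 'X_{1..N}) : bool :=
  [exists v, (m1 v < m2 v)%N && [forall w, gt w v ==> (m1 w == m2 w)]].

Definition lex_le (m1 m2 : 'X_{1..N}) : bool := (m1 == m2) || lex_lt m1 m2.

Lemma lex_ltP (m1 m2 : 'X_{1..N}) :
  reflect (exists v, (m1 v < m2 v)%N /\ forall w, gt w v -> m1 w = m2 w)
          (lex_lt m1 m2).
Proof.
apply: (iffP existsP) => -[v].
  by case/andP=> lt /forallP h; exists v; split=> // w /(implyP (h w)) /eqP.
by case=> lt h; exists v; rewrite lt; apply/forallP => w; apply/implyP => /h ->.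
Qed.

Hypothesis gt_irr : irreflexive gt.
Hypothesis gt_trans : transitive gt.
Hypothesis gt_total : forall v w, v != w -> gt v w || gt w v.

Lemma lex_lt_trans : transitive lex_lt.
Proof.
move=> m2 m1 m3 /lex_ltP[v [ltv hv]] /lex_ltP[w [ltw hw]]; apply/lex_ltP.
have [evw|nvw] := eqVneq v w.
  subst w; exists v; split; first exact: ltn_trans ltw.
  by move=> u gu; rewrite hv ?hw.
case/orP: (gt_total nvw) => g.
  exists v; rewrite -hw //; split=> // u gu.
  by rewrite hv // hw // (gt_trans gu g).
exists w; rewrite hv //; split=> // u gu.
by rewrite hv ?hw // (gt_trans gu g).
Qed.

Lemma lex_lt_irr : irreflexive lex_lt.
Proof. by move=> m; apply/lex_ltP => -[v []]; rewrite ltnn. Qed.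

Lemma lex_le_anti : antisymmetric lex_le.
Proof.
move=> m1 m2 /andP[/orP[/eqP //|l1] /orP[/eqP //|l2]].
by have := lex_lt_trans l1 l2; rewrite lex_lt_irr.
Qed.

Lemma lex_le_trans : transitive lex_le.
Proof.
move=> m2 m1 m3 /orP[/eqP -> //|l1] /orP[/eqP <-|l2]; apply/orP; right=> //.
exact: lex_lt_trans l2.
Qed.

Lemma lex_le_total : total lex_le.
Proof.
move=> m1 m2; have [->|ne] := eqVneq m1 m2; first by rewrite /lex_le eqxx.
have [v0 dv0] : exists v, m1 v != m2 v.
  apply/existsP; apply: contraNT ne; rewrite negb_exists => /forallP h.
  by apply/eqP/mnmP => v; apply/eqP; have := h v; rewrite negbK.
pose above v := #|[set w | gt w v]|.
case: (@arg_minnP _ v0 (fun v => m1 v != m2 v) above dv0) => v dv minv.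
have hv w : gt w v -> m1 w = m2 w.
  move=> gwv; apply/eqP; apply/negPn/negP => dw.
  have := minv w dw; rewrite leqNgt => /negP; apply.
  apply: proper_card; apply/properP; split.
    by apply/subsetP => u; rewrite !inE => /gt_trans; apply.
  by exists w; rewrite !inE ?gt_irr.
have [l|l|e] := ltngtP (m1 v) (m2 v); last by rewrite e eqxx in dv.
  by apply/orP; left; apply/orP; right; apply/lex_ltP; exists v.
apply/orP; right; apply/orP; right; apply/lex_ltP; exists v; split=> // w g.
by rewrite hv.
Qed.

Lemma lex_le_add2r m m1 m2 : lex_le m1 m2 -> lex_le (m1 + m)%MM (m2 + m)%MM.
Proof.
case/orP=> [/eqP -> |/lex_ltP[v [l h]]]; first by rewrite /lex_le eqxx.
apply/orP; right; apply/lex_ltP; exists v; rewrite !mnmDE ltn_add2r.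
by split=> // w g; rewrite !mnmDE h.
Qed.

Lemma lex_le0m m : lex_le 0%MM m.
Proof.
case/orP: (lex_le_total 0%MM m) => // /orP[/eqP ->|]; first exact/orP/or_introl.
by case/lex_ltP => v; rewrite mnm0E ltn0 => -[].
Qed.

Definition lex_order : termOrder N :=
  TermOrder lex_le_anti lex_le_trans lex_le_total lex_le0m lex_le_add2r.

End Lex.

(* The rational normal scroll.  Indices start at 0: i : 'I_n stands for i + 1
   in 1..n, while j : 'I_(lam i).+1 ranges over 0..lam i. *)
Section Scroll.
Variables (n : nat) (lam : 'I_n -> nat).

Definition scroll_index : finType := {i : 'I_n & 'I_(lam i).+1}.

Definition scroll_dim : nat := #|scroll_index|.

(* enum_val and enum_rank identify 'I_scroll_dim with the pairs (i, j). *)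
Definition index_i (v : 'I_scroll_dim) : nat := tag (enum_val v).
Definition index_j (v : 'I_scroll_dim) : nat := tagged (enum_val v).

Definition scroll_gt (v w : 'I_scroll_dim) : bool :=
  (index_j v < index_j w)%N
  || ((index_j v == index_j w) && (index_i v < index_i w)%N).

Lemma scroll_gt_irr : irreflexive scroll_gt.
Proof. by move=> v; rewrite /scroll_gt !ltnn andbF. Qed.

Lemma scroll_gt_trans : transitive scroll_gt.
Proof.
move=> v u w; rewrite /scroll_gt.
case/orP=> [l1|/andP[/eqP -> l1]]; case/orP=> [l2|/andP[/eqP <- l2]].
- by rewrite (ltn_trans l1 l2).
- by rewrite l1.
- by rewrite l2.
by rewrite eqxx (ltn_trans l1 l2) orbT.
Qed.

Lemma scroll_gt_total v w : v != w -> scroll_gt v w || scroll_gt w v.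
Proof.
apply: contraNT; rewrite /scroll_gt /index_i /index_j -(inj_eq enum_val_inj).
case: (enum_val v) (enum_val w) => [i j] [i' j'] /=.
have [//|//|ej] := ltngtP (nat_of_ord j) j'.
have [//|//|/ord_inj ei] := ltngtP (nat_of_ord i) i'.
by subst i' => _; rewrite (ord_inj ej).
Qed.

Definition scroll_lex : termOrder scroll_dim :=
  lex_order scroll_gt_irr scroll_gt_trans scroll_gt_total.

Variable K : fieldType.

(* K[s, t_1, ..., t_n] is {mpoly K[n.+1]}: s is variable 0 and t_i is the
   variable of index lift ord0 i, the i-th one after it. *)
Definition scroll_param (v : 'I_scroll_dim) : {mpoly K[n.+1]} :=
  'X_ord0 ^+ index_j v * 'X_(lift ord0 (tag (enum_val v))).

Definition toric_ideal (f : {mpoly K[scroll_dim]}) : Prop :=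
  f \mPo [tuple scroll_param v | v < scroll_dim] = 0.

End Scroll.

Arguments toric_ideal {n} lam K f.

(* Main.v *)
(* Order the variables by position [pos (i, j) = j * n + i].  Both ideals are
   the ideal of all monomials whose support contains a clique: [r + 1] variables
   whose positions are pairwise more than [n] apart.  A greedy argument shows
   that a set of variables without such a clique is covered by [r] windows of
   length [n].

   A clique monomial is the leading monomial of an (r+1)-minor of the block
   Hankel matrix; the equality of the lambda_i makes this minor fit, and it lies
   in the secant ideal since a sum of [r] matrices of rank 1 has rank at most
   [r].  It lies in the secant of the initial ideal by the pigeonhole principle.
   Conversely, let [f] be in the secant ideal with a leading monomial [m]
   coloured by windows.  A monomial supported in a window is the lex-smallest
   one with its toric image, so in [f (y_1 + ... + y_r)] the monomial splitting
   [m] along its colours is alone in its toric fibre; its coefficient, which is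
   that of [m] in [f], must vanish.  A polynomial in the secant of the initial
   ideal has no coloured monomial: the initial ideal is generated by the cliques
   of size 2, which die under [y_{k,v}] -> [x_v] if [v] has colour [k], 0 if
   not. *)

Require Import Defs.
From mathcomp Require Import all_boot all_order all_fingroup all_algebra.
From mathcomp Require Import mpoly.
From mathcomp Require Import zify ring.

Set Implicit Arguments.
Unset Strict Implicit.
Unset Printing Implicit Defensive.

Import GRing.Theory.
Local Open Scope ring_scope.

(** * Monomial substitutions and composition of polynomial maps *)

Section MonomialMaps.
Variables (N M : nat) (tau : 'I_N -> 'X_{1..M}).

Definition mnm_map (a : 'X_{1..N}) : 'X_{1..M} :=
  (\sum_(v < N) tau v *+ a v)%MM.

Lemma mnm_mapE a l : mnm_map a l = (\sum_(v < N) tau v l * a v)%N.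
Proof. by rewrite mnm_sumE; apply: eq_bigr => v _; rewrite mulmnE. Qed.

Lemma mnm_mapD a b : mnm_map (a + b)%MM = (mnm_map a + mnm_map b)%MM.
Proof.
apply/mnmP => l; rewrite mnmDE !mnm_mapE -big_split /=.
by apply: eq_bigr => v _; rewrite mnmDE mulnDr.
Qed.

Lemma comp_mpoly_monomialX (R : comNzRingType) a :
  'X_[a] \mPo [tuple 'X_[R, tau v] | v < N] = 'X_[mnm_map a].
Proof.
rewrite comp_mpolyX (big_morph _ (@mpolyXD _ R) (@mpolyX0 _ R)).
by apply: eq_bigr => v _; rewrite tnth_mktuple mpolyXn.
Qed.

End MonomialMaps.

Section Composition.
Variable R : comNzRingType.

Lemma comp_mpolyA k l N (p : {mpoly R[N]}) (t : 'I_N -> {mpoly R[k]})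
    (u : k.-tuple {mpoly R[l]}) :
  (p \mPo [tuple t i | i < N]) \mPo u = p \mPo [tuple t i \mPo u | i < N].
Proof.
rewrite [X in X \mPo u]comp_mpolyEX [RHS]comp_mpolyEX raddf_sum /=.
apply: eq_bigr => m _; rewrite comp_mpolyZ !comp_mpolyX rmorph_prod; congr (_ *: _).
by apply: eq_bigr => i _; rewrite rmorphXn !tnth_mktuple.
Qed.

Lemma eq_comp_mpoly k N (t u : 'I_N -> {mpoly R[k]}) (p : {mpoly R[N]}) :
  t =1 u -> p \mPo [tuple t i | i < N] = p \mPo [tuple u i | i < N].
Proof.
move=> tu; congr (comp_mpoly _ _).
by apply: eq_from_tnth => i; rewrite !tnth_mktuple.
Qed.

Lemma comp_mpolyXt k N (t : 'I_N -> {mpoly R[k]}) i :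
  'X_i \mPo [tuple t i | i < N] = t i.
Proof. by rewrite comp_mpolyXU -tnth_nth tnth_mktuple. Qed.

Lemma mcoeff_comp N k (f : {mpoly R[N]}) 
    (u : N.-tuple {mpoly R[k]}) m :
  (f \mPo u)@_m = \sum_(a <- msupp f) f@_a * ('X_[a] \mPo u)@_m.
Proof.
rewrite comp_mpolyEX raddf_sum /=.
by apply: eq_bigr => a _; rewrite mcoeffZ.
Qed.

End Composition.

(** * Generated ideals, congruences and determinants *)

Section Ideals.
Variables (K : fieldType) (N : nat) (S : {mpoly K[N]} -> Prop).
Local Notation J := (ideal_gen S).

Lemma ideal_gen_ind (Q : {mpoly K[N]} -> Prop) :
  Q 0 -> (forall p q, Q p -> Q q -> Q (p + q)) -> (forall p q, Q q -> Q (p * q)) ->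
  (forall p, S p -> Q p) -> forall p, J p -> Q p.
Proof.
move=> Q0 QD QM QS p [s [Ss ->]]; rewrite big_seq.
by apply: (big_ind Q) => // c cs; apply/QM/QS/Ss.
Qed.

Lemma ideal_gen_base p : S p -> J p.
Proof.
move=> Sp; exists [:: (1, p)]; split; last by rewrite big_seq1 mul1r.
by move=> c; rewrite inE => /eqP ->.
Qed.

Lemma ideal_gen0 : J 0.
Proof. by exists [::]; rewrite big_nil. Qed.

Lemma ideal_genD p q : J p -> J q -> J (p + q).
Proof.
move=> [s [Ss ->]] [t [St ->]]; exists (s ++ t); rewrite big_cat; split=> // c.
by rewrite mem_cat => /orP[/Ss|/St].
Qed.

Lemma ideal_genM p q : J q -> J (p * q).
Proof.
move=> [s [Ss ->]]; exists [seq (p * c.1, c.2) | c <- s]; split.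
  by move=> _ /mapP[c /Ss Sc ->].
by rewrite big_map mulr_sumr; apply: eq_bigr => c _; rewrite mulrA.
Qed.

Lemma ideal_genN p : J p -> J (- p).
Proof. by rewrite -mulN1r; apply: ideal_genM. Qed.

Lemma ideal_gen_sum (I : Type) (r : seq I) (P : pred I) (F : I -> {mpoly K[N]}) :
  (forall i, P i -> J (F i)) -> J (\sum_(i <- r | P i) F i).
Proof. exact: (big_ind J ideal_gen0 ideal_genD). Qed.

Lemma ideal_gen_prodB (I : Type) (r : seq I) (F G : I -> {mpoly K[N]}) :
  (forall i, J (F i - G i)) -> J (\prod_(i <- r) F i - \prod_(i <- r) G i).
Proof.
move=> FG; elim: r => [|i r IH]; first by rewrite !big_nil subrr; apply: ideal_gen0.
rewrite !big_cons; set f := \prod_(j <- r) F j in IH *.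
set g := \prod_(j <- r) G j in IH *.
have -> : F i * f - G i * g = F i * (f - g) + g * (F i - G i) by ring.
by apply: ideal_genD; apply: ideal_genM.
Qed.

Lemma ideal_gen_compB M (p : {mpoly K[M]}) (t u : 'I_M -> {mpoly K[N]}) :
  (forall i, J (t i - u i)) ->
  J ((p \mPo [tuple t i | i < M]) - (p \mPo [tuple u i | i < M])).
Proof.
move=> tu; rewrite !comp_mpolyE -sumrB; apply: ideal_gen_sum => m _.
rewrite -scalerBr -mul_mpolyC; apply: ideal_genM.
apply: ideal_gen_prodB => i; rewrite !tnth_mktuple subrXX mulrC.
exact: ideal_genM.
Qed.

(* Swapping the entries chosen in the rows [i1] and [i2] pairs the terms of the
   Leibniz formula into multiples of 2-minors of these two rows. *)
Lemma ideal_gen_det q (A : 'M[{mpoly K[N]}]_q) i1 i2 :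
  i1 != i2 ->
  (forall k1 k2, J (A i1 k1 * A i2 k2 - A i1 k2 * A i2 k1)) -> J (\det A).
Proof.
move=> n12 JA; pose t := tperm i1 i2.
have otp s : odd_perm (t * s)%g = ~~ odd_perm s by rewrite odd_permM odd_tperm n12.
rewrite /determinant (bigID (@odd_perm _)) /= addrC.
rewrite [X in _ + X](reindex_inj (mulgI t)) /=.
under [X in _ + X]eq_bigl do rewrite otp.
rewrite -big_split; apply: ideal_gen_sum => s /negPf evs /=.
rewrite otp evs expr0 mul1r expr1 mulN1r.
rewrite (bigD1 i1) //= (bigD1 i2) 1?eq_sym //= !mulrA.
rewrite [X in _ - X](bigD1 i1) //= [X in _ - (_ * X)](bigD1 i2) 1?eq_sym //= !mulrA.
rewrite !permM tpermL tpermR.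
under [X in _ - _ * X]eq_bigr => i /andP[ni1 ni2].
  by rewrite permM tpermD 1?eq_sym //; over.
by rewrite -mulrBl mulrC; apply: ideal_genM.
Qed.

End Ideals.

(** Multilinearity in the rows: each term chooses one summand per row. With fewer summands than
    rows, two rows share a summand, and 2-minors of these rows control the term. *)
Lemma det_sum_rows (R : comNzRingType) q r (A : 'I_r -> 'M[R]_q) :
  \det (\matrix_(i, k) \sum_(j < r) A j i k) =
  \sum_(c : {ffun 'I_q -> 'I_r}) \det (\matrix_(i, k) A (c i) i k).
Proof.
rewrite exchange_big /=; apply: eq_bigr => s _; rewrite -mulr_sumr; congr (_ * _).
under eq_bigr do rewrite mxE.
rewrite bigA_distr_bigA; apply: eq_bigr => c _.
by apply: eq_bigr => i _; rewrite mxE.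
Qed.

Lemma ffun_collision q r (c : {ffun 'I_q -> 'I_r}) :
  (r < q)%N -> exists i1 i2, i1 != i2 /\ c i1 = c i2.
Proof.
move=> rq; case: (boolP (injectiveb c)) => [/injectiveP /leq_card|].
  by rewrite !card_ord leqNgt rq.
by case/injectivePn => x [y nxy cxy]; exists x, y.
Qed.

(** * Introduction and elimination rules for secant ideals *)

Section SecantIdeals.
Variables (K : fieldType) (N r : nat) (I : {mpoly K[N]} -> Prop).

Lemma secant0 : secant r I 0.
Proof. by rewrite /secant raddf0; apply: ideal_gen0. Qed.

Lemma secantD p q : secant r I p -> secant r I q -> secant r I (p + q).
Proof. by rewrite /secant raddfD; apply: ideal_genD. Qed.

Lemma secantM p q : secant r I q -> secant r I (p * q).
Proof. by rewrite /secant rmorphM; apply: ideal_genM. Qed.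

(** Modulo the linear generators, each [x_i] may be replaced by the sum of its copies [y_{ji}], so
    only the copies of [I] matter. Quantifying over [S] hides the full generating set. *)
Lemma secant_intro p :
  (forall S : {mpoly K[N + r * N]} -> Prop,
     (forall (j : 'I_r) f, I f -> S (f \mPo [tuple @yvar K N r j i | i < N])) ->
     ideal_gen S (p \mPo [tuple \sum_(j < r) @yvar K N r j i | i < N])) ->
  secant r I p.
Proof.
rewrite /secant; set S := (X in ideal_gen X); move=> /(_ S) h.
rewrite -[X in _ X](subrK (p \mPo [tuple \sum_(j < r) @yvar K N r j i | i < N])).
apply: ideal_genD; last by apply: h => j f If; left; exists j, f.
apply: ideal_gen_compB => i; rewrite -opprB; apply: ideal_genN.
by apply: ideal_gen_base; right; exists i.
Qed.

(** The substitution [y_{ji} := g j i], [x_i := \sum_j g j i] kills the linear generators, so an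
    ideal [Q] that receives every copy of [I] receives the secant ideal. The tuple [t] follows the
    layout of the variables: the [x_i] first, then the flattened [y_{ji}]. *)
Lemma secant_comp M (Q : {mpoly K[M]} -> Prop)
    (g : 'I_r -> 'I_N -> {mpoly K[M]}) p :
  Q 0 -> (forall p q, Q p -> Q q -> Q (p + q)) -> (forall p q, Q q -> Q (p * q)) ->
  (forall j f, I f -> Q (f \mPo [tuple g j i | i < N])) ->
  secant r I p -> Q (p \mPo [tuple \sum_(j < r) g j i | i < N]).
Proof.
move=> Q0 QD QM Qg.
pose t := [tuple row_mx (\row_i \sum_(j < r) g j i)
             (mxvec (\matrix_(j, i) g j i)) 0 w | w < N + r * N].
have tx i : xvar K r i \mPo t = \sum_(j < r) g j i.
  by rewrite comp_mpolyXt row_mxEl mxE.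
have ty j i : @yvar K N r j i \mPo t = g j i.
  by rewrite comp_mpolyXt row_mxEr mxvecE mxE.
have -> : p \mPo [tuple \sum_(j < r) g j i | i < N] =
    (p \mPo [tuple xvar K r i | i < N]) \mPo t.
  by rewrite comp_mpolyA; apply: eq_comp_mpoly.
rewrite /secant; move: (p \mPo _); apply: ideal_gen_ind => [|p1 p2|p1 p2|q].
- by rewrite raddf0.
- by rewrite raddfD; apply: QD.
- by rewrite rmorphM; apply: QM.
case=> [[j [f If ->]]|[i ->]]; last first.
  by rewrite raddfB raddf_sum /= tx (eq_bigr (g^~ i)) ?subrr.
rewrite comp_mpolyA (_ : f \mPo _ = f \mPo [tuple g j i | i < N]); first exact: Qg.
exact: eq_comp_mpoly.
Qed.

(** Expanding the product of sums chooses a copy [j] for each of the [q > r] factors; two factors in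
    the same copy give a multiple of a generator. *)
Lemma secant_prod q (e : 'I_q -> 'I_N) :
  (r < q)%N -> (forall i1 i2, i1 != i2 -> I ('X_(e i1) * 'X_(e i2))) ->
  secant r I (\prod_(i < q) 'X_(e i)).
Proof.
move=> rq Ie; apply: secant_intro => S IS.
rewrite rmorph_prod (eq_bigr (fun i => \sum_(j < r) @yvar K N r j (e i))); last first.
  by move=> i _ /=; rewrite comp_mpolyXt.
rewrite bigA_distr_bigA; apply: ideal_gen_sum => c _.
have [i1 [i2 [n12 c12]]] := ffun_collision c rq.
rewrite (bigD1 i1) //= (bigD1 i2) 1?eq_sym //= mulrA mulrC; apply: ideal_genM.
apply: ideal_gen_base; have := IS (c i1) _ (Ie _ _ n12).
by rewrite rmorphM /= !comp_mpolyXt c12.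
Qed.

Lemma secant_det q (v : 'I_q -> 'I_q -> 'I_N) :
  (r < q)%N ->
  (forall i1 i2 k1 k2, i1 != i2 ->
     I ('X_(v i1 k1) * 'X_(v i2 k2) - 'X_(v i1 k2) * 'X_(v i2 k1))) ->
  secant r I (\det (\matrix_(i, k) 'X_(v i k))).
Proof.
move=> rq Iv; apply: secant_intro => S IS; rewrite -det_map_mx /=.
set A := map_mx _ _.
have -> : A = \matrix_(i, k) \sum_(j < r)
    (\matrix_(i, k) @yvar K N r j (v i k) : 'M__) i k.
  apply/matrixP => i k; rewrite !mxE comp_mpolyXt.
  by apply: eq_bigr => j _; rewrite mxE.
rewrite det_sum_rows; apply: ideal_gen_sum => c _.
have [i1 [i2 [n12 c12]]] := ffun_collision c rq.
apply: (ideal_gen_det n12) => k1 k2; rewrite !mxE.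
apply: ideal_gen_base; have := IS (c i1) _ (Iv i1 i2 k1 k2 n12).
by rewrite comp_mpolyB !rmorphM /= !comp_mpolyXt c12.
Qed.

End SecantIdeals.

(** * Term orders on sums of monomials, and gradings *)

Section TermOrders.
Variables (N : nat) (le : termOrder N).

Lemma tle_refl m : le m m.
Proof. by have := tle_total le m m; rewrite orbb. Qed.

Lemma tle_sum (I : finType) (P : pred I) (a m : I -> 'X_{1..N}) :
  (forall k, le (m k) (a k)) ->
  le (\sum_(k | P k) m k)%MM (\sum_(k | P k) a k)%MM.
Proof.
move=> ma; elim/big_rec2: _ => [|k x y _ xy]; first exact: tle_refl.
apply: (tle_trans (y := (m k + x)%MM)); last exact: tle_add2r.
by rewrite !(addmC (m k)); apply: tle_add2r.
Qed.

(** A strict inequality in one summand would survive in the total, since monomials cancel. *)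
Lemma tle_sum_eq (I : finType) (a m : I -> 'X_{1..N}) :
  (forall k, le (m k) (a k)) -> le (\sum_k a k)%MM (\sum_k m k)%MM ->
  forall k, a k = m k.
Proof.
move=> ma am k; move: am; rewrite (bigD1 k) //= [X in le _ X](bigD1 k) //=.
set a' := (\sum_(i | _) a i)%MM; set m' := (\sum_(i | _) m i)%MM => am.
have l1 : le (a k + m')%MM (m k + m')%MM.
  apply: tle_trans am; rewrite !(addmC (a k)); apply: tle_add2r.
  exact: tle_sum.
have l2 := tle_add2r (t := le) m' (ma k).
by apply: (@addIm _ m'); apply: (tle_anti (t := le)); rewrite l1 l2.
Qed.

Variable K : fieldType.

Lemma initial_ideal_lead (I : {mpoly K[N]} -> Prop) f m :
  I f -> is_lead_mon le f m -> initial_ideal le I 'X_[m].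
Proof. by move=> If fm; apply: ideal_gen_base; exists f, m. Qed.

End TermOrders.

Section Homogeneity.
Variables (R : comNzRingType) (M L : nat) (wt : 'I_M -> 'X_{1..L}).

Definition homogeneous (a : 'X_{1..L}) (p : {mpoly R[M]}) : Prop :=
  forall u, u \in msupp p -> mnm_map wt u = a.

Lemma homogeneousM a b p q :
  homogeneous a p -> homogeneous b q -> homogeneous (a + b)%MM (p * q).
Proof.
move=> pa qb u /msuppM_le/allpairsP[[u1 u2] /= [/pa <- /qb <- ->]].
exact: mnm_mapD.
Qed.

Lemma homogeneous1 : homogeneous 0%MM 1.
Proof.
move=> u; rewrite msupp1 inE => /eqP ->; apply/mnmP => l.
by rewrite mnm_mapE mnm0E big1 // => v _; rewrite mnm0E muln0.
Qed.

(** Substitution sends ['X_[a]] to a polynomial of weight [a], so the weight of a monomial of the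
    composite tells which monomial of [f] it comes from. *)
Lemma msupp_comp_graded (f : {mpoly R[L]}) (t : 'I_L -> {mpoly R[M]}) u :
  (forall i, homogeneous U_(i)%MM (t i)) ->
  u \in msupp (f \mPo [tuple t i | i < L]) -> mnm_map wt u \in msupp f.
Proof.
move=> ht; rewrite comp_mpolyE => /msupp_sum_le /flattenP[s].
case/mapP => a; rewrite mem_filter /= => af -> /msuppZ_le ut.
suff -> : mnm_map wt u = a by [].
rewrite [a in RHS]multinomUE_id; move: u ut; rewrite -/(homogeneous _ _).
apply: (big_ind2 homogeneous); first exact: homogeneous1.
  by move=> b p d q; apply: homogeneousM.
move=> i _; rewrite tnth_mktuple; elim: (a i) => [|k IH].
  by rewrite mulm0n; apply: homogeneous1.
by rewrite exprS mulmS; apply: homogeneousM.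
Qed.

End Homogeneity.

(** * Monomials in [r] copies of the variables *)

Section PairIndex.
Variables (r N : nat).

Lemma mxvec_index_eq (k1 k2 : 'I_r) (v1 v2 : 'I_N) :
  (mxvec_index k1 v1 == mxvec_index k2 v2) = (k1 == k2) && (v1 == v2).
Proof.
by rewrite (inj_eq (@cast_ord_inj _ _ _)) (inj_eq enum_rank_inj) xpair_eqE.
Qed.

Lemma sum_mxvec_index (F : 'I_(r * N) -> nat) :
  (\sum_w F w = \sum_k \sum_v F (mxvec_index k v))%N.
Proof.
by rewrite (reindex _ (curry_mxvec_bij r N)) pair_bigA; apply: eq_bigr => -[].
Qed.

Definition uncurry_ord T (g : 'I_r -> 'I_N -> T) (w : 'I_(r * N)) : T :=
  mxvec (\matrix_(k, v) g k v) 0 w.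

Lemma uncurry_ordE T (g : 'I_r -> 'I_N -> T) k v :
  uncurry_ord g (mxvec_index k v) = g k v.
Proof. by rewrite /uncurry_ord mxvecE mxE. Qed.

Definition block (u : 'X_{1..r * N}) (k : 'I_r) : 'X_{1..N} :=
  [multinom u (mxvec_index k v) | v < N].

Lemma block_inj u1 u2 : block u1 =1 block u2 -> u1 = u2.
Proof.
move=> e; apply/mnmP => w; case/mxvec_indexP: w => k v.
by have /mnmP/(_ v) := e k; rewrite !mnmE.
Qed.

(** Adding the blocks identifies all copies of a variable; seen as a weight, this is the grading
    used for [f (y_1 + ... + y_r)]. *)
Lemma sum_block u :
  (\sum_k block u k)%MM = mnm_map (uncurry_ord (fun _ v => U_(v)%MM)) u.
Proof.
apply/mnmP => v; rewrite mnm_sumE mnm_mapE sum_mxvec_index.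
apply: eq_bigr => k _; rewrite mnmE (bigD1 v) //= uncurry_ordE.
rewrite mnm1E eqxx mul1n big1 ?addn0 // => v' /negPf nv.
by rewrite uncurry_ordE mnm1E nv.
Qed.

End PairIndex.

(** * Cliques against window colourings *)

Section Cliques.
Variables (V : finType) (n : nat) (pos : V -> nat).

(** The sequence is total on [nat], which makes prepending and restricting easy; only its values
    below [r] count. *)
Definition clique (r : nat) (A : pred V) : Prop :=
  exists e : nat -> V, (forall i, (i < r)%N -> A (e i)) /\
    forall i j, (i < j < r)%N -> (pos (e i) + n < pos (e j))%N.

(** Open a window at the leftmost element [a] of [A] and recurse on what lies beyond it: a clique
    found there extends by [a], a colouring there by the new window. *)
Lemma greedy_colouring r (A : pred V) :
  clique r.+1 A \/ exists (c : V -> nat) (start : nat -> nat), forall v, A v ->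
    (c v < r)%N && (start (c v) <= pos v <= start (c v) + n)%N.
Proof.
elim: r A => [|r IH] A; (case: (pickP A) => [a0 Aa0|A0];
  last by right; exists (fun=> 0%N), id => v; rewrite A0).
  left; exists (fun=> a0); split=> // i j; lia.
case: (arg_minnP pos Aa0) => a Aa min_a.
have [[e [Ae gap]]|[c [start cP]]] := IH [pred v | A v && (pos a + n < pos v)%N].
  left; exists (fun i => if i is i'.+1 then e i' else a); split.
    by case=> // i /Ae /andP[].
  case=> [|i] [|j] //; last exact: gap.
  by move=> /andP[_ ltj]; have /andP[] := Ae j ltj.
(* The colour [r] is free for the new window, as the recursive colours are below [r]. *)
right; exists (fun v => if (pos v <= pos a + n)%N then r else c v),
  (fun k => if k == r then pos a else start k) => v Av.
case: (leqP (pos v) (pos a + n)) => [le|gt].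
  by rewrite eqxx ltnSn /= le min_a.
have /andP[ltc] := cP v (introT andP (conj Av gt)).
by rewrite ltn_eqF // (ltnW ltc : (_ < r.+1)%N).
Qed.

(** The windows are closed, with [n + 1] positions: two elements of one window are at most [n] apart
    and never form a clique. *)
Definition window_colouring (r : nat) (A : pred V) (c : V -> 'I_r) : Prop :=
  exists start : 'I_r -> nat, forall v, A v ->
    (start (c v) <= pos v <= start (c v) + n)%N.

Lemma clique_or_colouring r (A : pred V) :
  (0 < r)%N -> clique r.+1 A \/ exists c : V -> 'I_r, window_colouring A c.
Proof.
case: r => // r _; have [|[c [start cP]]] := greedy_colouring r.+1 A; first by left.
right; exists (inord \o c), start => v /cP /andP[ltc].
by rewrite /= inordK.
Qed.

(** Summing the gaps keeps one unit of their strictness, the term [(i < j)]; [minor_vtx_gt] needs it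
    to compare entries strictly. *)
Lemma clique_gap r (e : nat -> V) :
  (forall i j, (i < j < r)%N -> (pos (e i) + n < pos (e j))%N) ->
  forall i j, (i <= j < r)%N -> (pos (e i) + n * (j - i) + (i < j) <= pos (e j))%N.
Proof.
move=> gap i; elim=> [|j IH] ij.
  by move: ij; rewrite leqn0 => /andP[/eqP -> _]; rewrite muln0 !addn0.
have [->|ne] := eqVneq i j.+1; first by rewrite subnn ltnn muln0 !addn0.
have {}IH : (pos (e i) + n * (j - i) <= pos (e j))%N.
  by apply: leq_trans (IH _); lia.
have := gap j j.+1; nia.
Qed.

End Cliques.

(** * Positions on the scroll and lex-minimality inside a window *)

Section Scroll.
Variables (n : nat) (lam : 'I_n -> nat).
Local Notation N := (scroll_dim lam).

Definition row_of (v : 'I_N) : 'I_n := tag (enum_val v).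

Definition vtx (i : 'I_n) (j : nat) : 'I_N :=
  enum_rank (Tagged (fun i => 'I_(lam i).+1) (inord j : 'I_(lam i).+1)).

Definition pos (v : 'I_N) : nat := index_j v * n + index_i v.

Lemma row_of_vtx i j : row_of (vtx i j) = i.
Proof. by rewrite /row_of enum_rankK. Qed.

Lemma index_j_vtx i j : (j <= lam i)%N -> index_j (vtx i j) = j.
Proof. by move=> le; rewrite /index_j enum_rankK /= inordK. Qed.

Lemma index_i_lt (v : 'I_N) : (index_i v < n)%N.
Proof. exact: ltn_ord. Qed.

Lemma index_j_le (v : 'I_N) : (index_j v <= lam (row_of v))%N.
Proof. by rewrite -ltnS /index_j; apply: ltn_ord. Qed.

Lemma vtxK v : vtx (row_of v) (index_j v) = v.
Proof.
rewrite -[RHS]enum_valK /vtx /row_of /index_j; congr enum_rank.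
by case: (enum_val v) => i j /=; rewrite inord_val.
Qed.

Lemma pos_div v : (pos v %/ n)%N = index_j v.
Proof.
have ltn := index_i_lt v.
by rewrite divnMDl ?(leq_ltn_trans _ ltn) // divn_small ?addn0.
Qed.

Lemma pos_mod v : (pos v %% n)%N = index_i v.
Proof. by rewrite modnMDl modn_small // index_i_lt. Qed.

Lemma pos_inj : injective pos.
Proof.
move=> v w e; rewrite -(vtxK v) -(vtxK w); congr vtx; last by rewrite -!pos_div e.
by apply: ord_inj; rewrite -[RHS]pos_mod -e pos_mod.
Qed.

Lemma scroll_gtE (v w : 'I_N) : scroll_gt v w = (pos v < pos w)%N.
Proof.
have := index_i_lt v; have := index_i_lt w; rewrite /scroll_gt /pos.
by case: ltngtP => [||->] /=; nia.
Qed.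

Definition toric_exp (v : 'I_N) : 'X_{1..n.+1} :=
  (U_(ord0) *+ index_j v + U_(lift ord0 (row_of v)))%MM.

Lemma scroll_paramE (K : fieldType) v : scroll_param K v = 'X_[toric_exp v].
Proof. by rewrite mpolyXD -mpolyXn. Qed.

Lemma toric_exp_map0 a :
  mnm_map toric_exp a ord0 = (\sum_v index_j v * a v)%N.
Proof.
rewrite mnm_mapE; apply: eq_bigr => v _.
by rewrite mnmDE mulmnE !mnm1E eqxx mul1n addn0.
Qed.

Lemma toric_exp_map_lift a i :
  mnm_map toric_exp a (lift ord0 i) = (\sum_(v | row_of v == i) a v)%N.
Proof.
rewrite mnm_mapE [RHS]big_mkcond; apply: eq_bigr => v _.
rewrite mnmDE mulmnE !mnm1E mul0n add0n (inj_eq lift_inj).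
by case: eqP => _; rewrite ?mul1n ?mul0n.
Qed.

(* [C] is congruent to [- p - 1] modulo [n], so the weight
   [(pos v + C) %/ n], whose total over a monomial is determined by its toric
   image, is constant on the window [p < pos v <= p + n], smaller before
   it and larger after it. *)
Lemma window_lex_min p (m a : 'X_{1..N}) :
  (forall v, (0 < m v)%N -> (p <= pos v <= p + n)%N) ->
  mnm_map toric_exp a = mnm_map toric_exp m -> scroll_lex lam m a.
Proof.
move=> win ma; have /orP[//|/orP[/eqP ->|]] := tle_total (scroll_lex lam) m a.
  exact: tle_refl.
(* Otherwise [a] is smaller than [m], and [w] is the largest variable where they differ. *)
case/lex_ltP => w [aw eqw]; exfalso.
have n_gt0 : (0 < n)%N by apply: leq_ltn_trans (index_i_lt w).
have rows i : (\sum_(v | row_of v == i) a v = \sum_(v | row_of v == i) m v)%N.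
  by rewrite -!toric_exp_map_lift ma.
pose C := (p.+1 * n - p.+1)%N; pose G v := ((pos v + C) %/ n)%N.
have GE v : G v = (index_j v + (row_of v + C) %/ n)%N.
  by rewrite /G -addnA divnMDl.
have sumG : (\sum_v G v * a v = \sum_v G v * m v)%N.
  have sumGE (b : 'X_{1..N}) : (\sum_v G v * b v = \sum_v index_j v * b v +
      \sum_(i < n) ((i + C) %/ n) * \sum_(v | row_of v == i) b v)%N.
    rewrite (partition_big row_of xpredT) //= [X in (X + _)%N](partition_big row_of xpredT) //=.
    rewrite -big_split; apply: eq_bigr => i _ /=.
    rewrite big_distrr /= -big_split; apply: eq_bigr => v /eqP <- /=.
    by rewrite GE mulnDl.
  rewrite !sumGE -!toric_exp_map0 ma; congr addn.
  by apply: eq_bigr => i _; rewrite rows.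
have sum1 : (\sum_v a v = \sum_v m v)%N.
  rewrite (partition_big row_of xpredT) //= [RHS](partition_big row_of xpredT) //=.
  by apply: eq_bigr => i _.
have Clt v : (pos v < p)%N -> a v = m v.
  move=> ltv; apply: eqw; rewrite scroll_gtE; apply: leq_trans ltv _.
  by have /andP[] := win w (leq_trans (ltn0Sn _) aw).
have Geq v : (pos v == p) -> (G v = p /\ a v <= m v)%N.
  move=> /eqP pv; split.
    rewrite /G /C pv; have -> : (p + (p.+1 * n - p.+1) = p * n + n.-1)%N by nia.
    by rewrite divnMDl // divn_small ?addn0 //; lia.
  have [->|ne] := eqVneq v w; first exact: ltnW.
  rewrite eqw // scroll_gtE ltn_neqAle (inj_eq pos_inj) ne pv.
  by have /andP[] := win w (leq_trans (ltn0Sn _) aw).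
have Gin v : (p < pos v <= p + n)%N -> (G v = p.+1)%N.
  move=> inv; rewrite /G /C.
  have -> : (pos v + (p.+1 * n - p.+1) = p.+1 * n + (pos v - p.+1))%N by nia.
  by rewrite divnMDl // divn_small ?addn0 //; lia.
have Ggt v : (p + n < pos v)%N -> (p.+2 <= G v /\ m v = 0)%N.
  move=> gtv; split.
    by rewrite /G /C leq_divRL //; nia.
  by apply/eqP; rewrite -leqn0 leqNgt; apply/negP => /win; lia.
(* Every [D v] is nonnegative, while their sum vanishes because [a] and [m] have equal degree and
   equal [G]-weight. So each [D v] is zero, and [a] and [m] agree outside [p < pos v <= p + n]. *)
pose D v := ((a v)%:Z - (m v)%:Z) * ((G v)%:Z - (p.+1)%:Z).
have D_ge0 v : 0 <= D v.
  rewrite /D; case: (ltngtP (pos v) p) => [/Clt -> | gtv | /eqP/Geq[-> le]].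
  - by rewrite subrr mul0r.
  - case: (leqP (pos v) (p + n)) => [lev|/Ggt[ge ->]]; last by nia.
    by rewrite Gin ?gtv // subrr mulr0.
  - by nia.
have sumD : \sum_v D v = 0.
  rewrite /D (eq_bigr (fun v => ((G v * a v)%N%:Z - (G v * m v)%N%:Z)
      - ((p.+1)%:Z * (a v)%:Z - (p.+1)%:Z * (m v)%:Z))); last first.
    by move=> v _; rewrite !PoszM; ring.
  rewrite !sumrB -!mulr_sumr -!(big_morph Posz PoszD (erefl _)) sumG sum1.
  by rewrite !subrr.
have D0 v : D v = 0.
  have/eqP := sumD; rewrite (Num.Theory.psumr_eq0 _ (fun v _ => D_ge0 v)).
  by move/allP/(_ v (mem_index_enum v))/eqP.
have out v : ~~ (p < pos v <= p + n)%N -> a v = m v.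
  case: (ltngtP (pos v) p) => [/Clt -> //| gtv | /eqP/Geq[Gv le]] /=.
    by rewrite -ltnNge => /Ggt[ge m0]; have := D0 v; rewrite /D m0; nia.
  by have := D0 v; rewrite /D Gv; nia.
have inw : (p < pos w <= p + n)%N.
  by apply: contraLR aw => /out ->; rewrite ltnn.
(* These [n] consecutive positions meet each row at most once, so the row sum forces [a w = m w]. *)
have := rows (row_of w); rewrite (bigD1 w) //= [RHS](bigD1 w) //=.
rewrite [in RHS](eq_bigr (fun v => a v)); first by lia.
move=> v /andP[/eqP rv ne]; symmetry; apply: out; apply: contra ne => inv.
rewrite -(vtxK v) -(vtxK w) rv; apply/eqP; congr vtx.
have iE : index_i v = index_i w by rewrite /index_i -!/(row_of _) rv.
by move: inv inw; rewrite /pos iE; nia.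
Qed.

(** * The toric ideal and leading monomials in its secants *)

Variable K : fieldType.
Local Notation I := (toric_ideal lam K).
Local Notation le := (scroll_lex lam).

Lemma toric_idealE f :
  I f <-> f \mPo [tuple 'X_[K, toric_exp v] | v < N] = 0.
Proof. by rewrite /toric_ideal (eq_comp_mpoly _ (scroll_paramE K)). Qed.

Lemma toric_quadric a b c d :
  row_of a = row_of d -> row_of b = row_of c ->
  (index_j a + index_j b = index_j c + index_j d)%N ->
  I ('X_a * 'X_b - 'X_c * 'X_d).
Proof.
move=> rad rbc ej; apply/toric_idealE.
rewrite comp_mpolyB !rmorphM /= !comp_mpolyXt -!mpolyXD.
suff -> : (toric_exp a + toric_exp b = toric_exp c + toric_exp d)%MM.
  by rewrite subrr.
apply/mnmP => l; rewrite !mnmDE !mulmnE rad rbc.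
by move: (U_(ord0)%MM l) ej => x ej; nia.
Qed.

Lemma toric_lex_lead_not_colourable r f m (c : 'I_N -> 'I_r) :
  secant r I f -> is_lead_mon le f m ->
  ~ window_colouring n pos [pred v | (0 < m v)%N] c.
Proof.
move=> fI [mf lead] [start win].
(* Each copy [k] of the scroll gets its own parameters [s] and [t_i]; [T0 k v] is the
   parametrization of [y_{k,v}]. *)
pose T0 (k : 'I_r) v :=
  mnm_map (fun l => U_(mxvec_index k l)%MM) (toric_exp v).
pose T := uncurry_ord T0.
pose F := f \mPo [tuple \sum_(k < r) 'X_(mxvec_index k v) | v < N]
  : {mpoly K[r * N]}.
have FT : F \mPo [tuple 'X_[T w] | w < r * N] = 0.
  rewrite comp_mpolyA (@eq_comp_mpoly _ _ _ _ (fun v => \sum_k 'X_[T0 k v])).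
    apply: (secant_comp (Q := eq^~ 0)) fI => [||p q ->|k g].
    - by [].
    - by move=> p q -> ->; rewrite addr0.
    - by rewrite mulr0.
    move/toric_idealE => g0.
    rewrite (@eq_comp_mpoly _ _ _ _ (fun v =>
      'X_[toric_exp v] \mPo [tuple 'X_(mxvec_index k l) | l < n.+1])).
      by rewrite -comp_mpolyA g0 raddf0.
    by move=> v; rewrite comp_mpoly_monomialX.
  move=> v; rewrite raddf_sum /=; apply: eq_bigr => k _.
  by rewrite comp_mpolyXt /T uncurry_ordE.
have T_block u k l : mnm_map T u (mxvec_index k l) =
    mnm_map toric_exp (block u k) l.
  rewrite !mnm_mapE sum_mxvec_index (bigD1 k) //= [X in (_ + X)%N]big1.
    rewrite addn0; apply: eq_bigr => v _; rewrite /T uncurry_ordE [block u k v]mnmE.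
    congr muln; rewrite /T0 mnm_mapE (bigD1 l) //= mnm1E eqxx mul1n big1 ?addn0 //.
    by move=> l' /negPf nl; rewrite mnm1E mxvec_index_eq nl andbF.
  move=> k' /negPf nk; apply: big1 => v _; rewrite /T uncurry_ordE /T0 mnm_mapE.
  by rewrite big1 // => l' _; rewrite mnm1E mxvec_index_eq nk.
have F_supp u : u \in msupp F -> (\sum_(k < r) block u k)%MM \in msupp f.
  rewrite sum_block; apply: msupp_comp_graded => v w /msupp_sum_le/flattenP[s /mapP[k _ ->]].
  rewrite msuppX inE => /eqP ->; apply/mnmP => v'; rewrite mnm_mapE.
  rewrite (bigD1 (mxvec_index k v)) //= mnm1E eqxx muln1 uncurry_ordE.
  by rewrite big1 ?addn0 // => w' nw; rewrite mnm1E eq_sym (negPf nw) muln0.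
(* [mk k] is the part of [m] of colour [k], and [u0] places it in the [k]-th copy. *)
pose mk k : 'X_{1..N} := [multinom if c v == k then m v else 0 | v < N].
pose u0 : 'X_{1..r * N} := [multinom uncurry_ord mk w | w < r * N].
have u0_block k : block u0 k = mk k.
  by apply/mnmP => v; rewrite !mnmE uncurry_ordE mnmE.
have sum_mk : (\sum_(k < r) mk k)%MM = m.
  apply/mnmP => v; rewrite mnm_sumE (bigD1 (c v)) //= mnmE eqxx big1 ?addn0 //.
  by move=> k /negPf nk; rewrite mnmE eq_sym nk.
(* Each [mk k] is lex-minimal in its toric fibre, so it is at most [block u k]; yet the blocks of
   [u] add up to a monomial of [f], at most [m]. Hence all are equal. *)
have fibre u : u \in msupp F -> mnm_map T u = mnm_map T u0 -> u = u0.
  move=> uF /mnmP eT; apply: block_inj => k; rewrite u0_block; move: k.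
  apply: (tle_sum_eq (le := le)) => [k|]; last first.
    by rewrite sum_mk; apply/lead/F_supp.
  apply: (@window_lex_min (start k)) => [v|].
    by rewrite mnmE; case: eqP => // <-; apply: win.
  by apply/mnmP => l; rewrite -T_block eT T_block u0_block.
have F_u0 : F@_u0 = 0.
  have := congr1 (mcoeff (mnm_map T u0)) FT; rewrite mcoeff0 mcoeff_comp.
  under eq_bigr do rewrite comp_mpoly_monomialX mcoeffX.
  case: (boolP (u0 \in msupp F)) => [u0F|/memN_msupp_eq0 -> //].
  rewrite (bigD1_seq u0) ?msupp_uniq //= eqxx mulr1 big_seq_cond big1 ?addr0 //.
  move=> u /andP[uF nu]; case: eqP => [/(fibre _ uF) e|]; last by rewrite mulr0.
  by rewrite e eqxx in nu.
pose X0 (k : 'I_r) v : {mpoly K[N]} := if c v == k then 'X_v else 0.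
(* Keeping only the copy [c v] of each variable turns [F] back into [f]. It remains to see that [u0]
   alone can contribute to [m]. *)
have fF : f = F \mPo [tuple uncurry_ord X0 w | w < r * N].
  rewrite comp_mpolyA -[LHS]comp_mpoly_id; apply: eq_comp_mpoly => v.
  rewrite raddf_sum (bigD1 (c v)) //= comp_mpolyXt uncurry_ordE /X0 eqxx.
  rewrite big1 ?addr0 // => k /negPf nk.
  by rewrite comp_mpolyXt uncurry_ordE eq_sym nk.
move: mf; rewrite mcoeff_msupp {1}fF mcoeff_comp big_seq big1 ?eqxx // => u uF.
have [->|/eqP nu] := eqVneq u u0; first by rewrite F_u0 mul0r.
(* Either [u] contains a variable sent to 0, or it respects the colours and is determined by the sum
   of its blocks. *)
have [[w uw0 Xw0]|nz] :
    (exists2 w, (0 < u w)%N & uncurry_ord X0 w = 0) \/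
    (forall w, (0 < u w)%N -> uncurry_ord X0 w != 0).
  case: (pickP (fun w => (0 < u w)%N && (uncurry_ord X0 w == 0))) => [w|no].
    by case/andP => uw /eqP Xw; left; exists w.
  by right => w uw; have := no w; rewrite uw => /negbT.
  rewrite comp_mpolyX (bigD1 w) //= tnth_mktuple Xw0 expr0n.
  by rewrite eqn0Ngt uw0 mul0r mcoeff0 mulr0.
have u_c k v : c v != k -> u (mxvec_index k v) = 0%N.
  move=> /negPf nk; apply/eqP; rewrite eqn0Ngt; apply/negP => /nz.
  by rewrite uncurry_ordE /X0 nk eqxx.
have -> : 'X_[u] \mPo [tuple uncurry_ord X0 w | w < r * N] =
    'X_[\sum_(k < r) block u k].
  rewrite sum_block -comp_mpoly_monomialX !comp_mpolyX; apply: eq_bigr => w _.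
  rewrite !tnth_mktuple; case/mxvec_indexP: w => k v.
  rewrite !uncurry_ordE /X0; case: eqP => // /eqP/u_c ->.
  by rewrite !expr0.
rewrite mcoeffX; case: eqP => [um|]; last by rewrite mulr0.
case: nu; apply: block_inj => k; rewrite u0_block; apply/mnmP => v.
rewrite !mnmE; case: (eqVneq (c v) k) => [<-|/u_c //].
rewrite -um mnm_sumE (bigD1 (c v)) //= mnmE big1 ?addn0 // => k' nk.
by rewrite mnmE u_c // eq_sym.
Qed.

(** * Minors of the block Hankel matrix *)

Hypothesis lam_eq : forall i k : 'I_n, lam i = lam k.

Section Minor.
Variables (r : nat) (e : nat -> 'I_N).
Hypothesis gap : forall i j, (i < j < r.+1)%N -> (pos (e i) + n < pos (e j))%N.

(* Column [k] runs through consecutive [j] in the row of [e k], with [e k] on the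
   diagonal; [minor_range] rules out truncation in the subtraction. *)
Definition minor_vtx (i k : nat) : 'I_N :=
  vtx (row_of (e k)) (index_j (e k) + i - k).

Let gap_lin := clique_gap gap.

(** The [k] gaps before [e k] leave room for [k] steps down in [j], the [r - k] gaps after it for
    [r - k] steps up. The upper bound is read off in the row of [e r] and carried to that of [e k]
    by [lam_eq]. *)
Lemma minor_range i k : (i <= r)%N -> (k <= r)%N ->
  (k <= index_j (e k) /\ index_j (e k) + i - k <= lam (row_of (e k)))%N.
Proof.
move=> ir kr; have h0 := @gap_lin 0%N k; have hr := @gap_lin k r.
have i0 := index_i_lt (e 0%N); have ik := index_i_lt (e k).
have ir' := index_i_lt (e r); have jr := index_j_le (e r).
rewrite (lam_eq (row_of (e k)) (row_of (e r))).
move: h0 hr; rewrite /pos subn0 /= ltnS ltnSn kr andbT => /(_ isT) h0 /(_ isT) hr.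
split; first by rewrite -ltnS -(ltn_pmul2r (leq_ltn_trans (leq0n _) i0)); nia.
suff : (index_j (e k) + (r - k) < (lam (row_of (e r))).+1)%N by lia.
by rewrite -(ltn_pmul2r (leq_ltn_trans (leq0n _) i0)); nia.
Qed.

Lemma index_j_minor_vtx i k : (i <= r)%N -> (k <= r)%N ->
  (index_j (minor_vtx i k) + k = index_j (e k) + i)%N.
Proof.
by move=> ir kr; have [? ?] := minor_range ir kr; rewrite index_j_vtx //; lia.
Qed.

Lemma row_of_minor_vtx i k : row_of (minor_vtx i k) = row_of (e k).
Proof. exact: row_of_vtx. Qed.

Lemma minor_vtx_diag k : minor_vtx k k = e k.
Proof. by rewrite /minor_vtx addnK vtxK. Qed.

Lemma pos_minor_vtx i k : (i <= r)%N -> (k <= r)%N ->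
  (pos (minor_vtx i k) + n * k = pos (e k) + n * i)%N.
Proof.
move=> ir kr; have := index_j_minor_vtx ir kr.
by rewrite /pos /index_i -!/(row_of _) row_of_minor_vtx; nia.
Qed.

(** Entry [(i, c)] has position at least [pos (e k) + n * (i - k) + (k < c)]. *)
Lemma minor_vtx_gt i k c : (k <= i <= r)%N -> (k <= c <= r)%N ->
  (i != k) || (c != k) -> (pos (e k) < pos (minor_vtx i c))%N.
Proof.
move=> /andP[ki ir] /andP[kc cr] ne.
have n_gt0 : (0 < n)%N := leq_ltn_trans (leq0n _) (index_i_lt (e k)).
have := pos_minor_vtx ir cr; have := @gap_lin k c; rewrite kc ltnS cr => /(_ isT).
have [ck|nck] := eqVneq c k.
  by rewrite ck eqxx orbF in ne *; rewrite subnn ltnn; nia.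
have -> : (k < c)%N by lia.
by nia.
Qed.

Definition minor : {mpoly K[N]} :=
  \det (\matrix_(i < r.+1, k < r.+1) 'X_(minor_vtx i k)).

Definition minor_mon (s : 'S_r.+1) : 'X_{1..N} :=
  (\sum_(i < r.+1) U_(minor_vtx i (s i)))%MM.

Lemma minorE : minor = \sum_(s : 'S_r.+1) (-1) ^+ s * 'X_[minor_mon s].
Proof.
apply: eq_bigr => s _; rewrite (big_morph _ (@mpolyXD _ K) (@mpolyX0 _ K)).
by congr (_ * _); apply: eq_bigr => i _; rewrite mxE.
Qed.

(** Let [k] be the first index moved by [s]. Rows above [k] contribute equally to both monomials;
    the later rows use columns from [k] on, where only the diagonal choice reaches [e k], the
    largest variable left. *)
Lemma minor_mon_lt (s : 'S_r.+1) :
  s != 1%g -> lex_lt (@scroll_gt n lam) (minor_mon s) (minor_mon 1%g).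
Proof.
move=> ns; have [k0 nk0] : exists k, s k != k.
  apply/existsP; apply: contraNT ns; rewrite negb_exists => /forallP fix_s.
  by apply/eqP/permP => k; rewrite perm1; apply/eqP; have := fix_s k; rewrite negbK.
case: (@arg_minnP _ k0 (fun k => s k != k) val nk0) => k nk min_k.
have s_lt (i : 'I_r.+1) : (i < k)%N -> s i = i.
  by move=> ik; apply/eqP; apply: contraTT ik => /min_k; rewrite -leqNgt.
have s_ge (i : 'I_r.+1) : (k <= i)%N -> (k <= s i)%N.
  move=> ki; rewrite leqNgt; apply/negP => sik.
  by have /perm_inj e_i := s_lt _ sik; rewrite e_i ltnNge ki in sik.
have ltr (i : 'I_r.+1) : (i <= r)%N by rewrite -ltnS.
have diag_ge (i : 'I_r.+1) : (k <= i)%N -> (pos (e k) <= pos (e i))%N.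
  move=> ki; have := @gap_lin k i; rewrite ki ltn_ord -addnA => /(_ isT).
  exact: (leq_trans (leq_addr _ _)).
have gt_s (i : 'I_r.+1) : (k <= i)%N -> (pos (e k) < pos (minor_vtx i (s i)))%N.
  move=> ki; apply: minor_vtx_gt; rewrite ?ki ?s_ge ?ltr //.
  have [/ord_inj ->|//] := eqVneq (i : nat) k.
  by rewrite -val_eqE in nk.
apply/lex_ltP; exists (e k); split=> [|w]; last first.
  rewrite scroll_gtE => wk; rewrite !mnm_sumE; apply: eq_bigr => i _.
  rewrite !mnm1E perm1; case: (ltnP i k) => [/s_lt -> //|ki].
  have -> : (minor_vtx i (s i) == w) = false.
    by apply/negP => /eqP ew; have := gt_s i ki; rewrite ew; lia.
  rewrite minor_vtx_diag; case: eqP => // ew.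
  by have := diag_ge i ki; rewrite ew; lia.
rewrite !mnm_sumE (bigD1 k) //= [X in (_ < X)%N](bigD1 k) //= !mnm1E perm1.
rewrite minor_vtx_diag eqxx.
have -> : (minor_vtx k (s k) == e k) = false.
  by apply/negP => /eqP ek; have := gt_s k (leqnn k); rewrite ek ltnn.
rewrite ltnS add0n; apply: leq_sum => i ni; rewrite !mnm1E perm1.
case: (ltnP i k) => [/s_lt -> //|ki].
have -> // : (minor_vtx i (s i) == e k) = false.
by apply/negP => /eqP ew; have := gt_s i ki; rewrite ew ltnn.
Qed.

Lemma minor_lead : is_lead_mon le minor (minor_mon 1%g).
Proof.
split=> [|m].
  rewrite mcoeff_msupp minorE raddf_sum (bigD1 1%g) //= odd_perm1 mul1r mcoeffX.
  rewrite eqxx big1 ?addr0 ?oner_neq0 // => s ns.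
  have -> : (-1) ^+ s = ((-1) ^+ s)%:MP :> {mpoly K[N]} by rewrite rmorphXn rmorphN1.
  rewrite mcoeffCM mcoeffX; case: eqP => [es|]; last by rewrite mulr0.
  have := minor_mon_lt ns; rewrite es lex_lt_irr //; exact: scroll_gt_trans.
rewrite minorE => /msupp_sum_le /flattenP[t /mapP[s _ ->]].
have -> : (-1) ^+ s = ((-1) ^+ s)%:MP :> {mpoly K[N]} by rewrite rmorphXn rmorphN1.
rewrite mul_mpolyC => /msuppZ_le; rewrite msuppX inE => /eqP ->.
have [->|ns] := eqVneq s 1%g; first exact: tle_refl.
by apply/orP; right; apply: minor_mon_lt.
Qed.

Lemma minor_quadric i1 i2 k1 k2 :
  (i1 <= r)%N -> (i2 <= r)%N -> (k1 <= r)%N -> (k2 <= r)%N ->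
  I ('X_(minor_vtx i1 k1) * 'X_(minor_vtx i2 k2) -
     'X_(minor_vtx i1 k2) * 'X_(minor_vtx i2 k1)).
Proof.
move=> hi1 hi2 hk1 hk2; apply: toric_quadric; rewrite ?row_of_minor_vtx //.
have := index_j_minor_vtx hi1 hk1; have := index_j_minor_vtx hi2 hk2.
have := index_j_minor_vtx hi1 hk2; have := index_j_minor_vtx hi2 hk1; lia.
Qed.

Lemma minor_mon1 : minor_mon 1%g = (\sum_(i < r.+1) U_(e i))%MM.
Proof. by apply: eq_bigr => i _; rewrite perm1 minor_vtx_diag. Qed.

Lemma secant_minor : secant r I minor.
Proof.
apply: (@secant_det _ _ _ _ _ (fun i k : 'I_r.+1 => minor_vtx i k)) => //.
by move=> i1 i2 k1 k2 _; apply: minor_quadric; rewrite -ltnS.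
Qed.

End Minor.

(** * Comparison of the two ideals *)

Lemma secant1 f : I f -> secant 1 I f.
Proof.
move=> If; apply: secant_intro => S IS; apply: ideal_gen_base.
rewrite (@eq_comp_mpoly _ _ _ _ (@yvar K N 1 ord0)) => [|i]; first exact: IS.
by rewrite big_ord1.
Qed.

Lemma initial_toric_edge a b :
  (pos a + n < pos b)%N -> initial_ideal le I ('X_a * 'X_b).
Proof.
move=> ab; pose e i := if i is 0%N then a else b.
have gap i j : (i < j < 2)%N -> (pos (e i) + n < pos (e j))%N.
  by case: i j => [|[|i]] [|[|j]] //; lia.
have -> : 'X_a * 'X_b = 'X_[K, minor_mon (r := 1) e 1%g].
  by rewrite minor_mon1 big_ord_recl big_ord1 mpolyXD.
(* For [r = 1] the minor is a quadric of the toric ideal itself. *)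
apply: initial_ideal_lead (minor_lead gap); rewrite /minor (expand_det_row _ ord0).
rewrite big_ord_recl big_ord1 /cofactor !det_mx11 !mxE /= expr0 expr1 mul1r mulN1r.
by rewrite mulrN; apply: (minor_quadric gap).
Qed.

Lemma initial_toric_supp u : (exists2 f, I f & is_lead_mon le f u) ->
  exists a b, [/\ (0 < u a)%N, (0 < u b)%N & (pos a + n < pos b)%N].
Proof.
case=> f If fu.
have [[e [ue gap]]|[c col]] :=
  @clique_or_colouring _ n pos 1 [pred v | (0 < u v)%N] isT.
  by exists (e 0%N), (e 1%N); split; [apply: ue | apply: ue | apply: gap].
by case: (toric_lex_lead_not_colourable (secant1 If) fu col).
Qed.

(** Polynomials all of whose monomials contain a one-coloured edge form an ideal [Q]. The
    specialization [X0] fixes [p] and maps each copy of the initial ideal into [Q], but a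
    one-coloured edge does not fit in a window. *)
Lemma secant_initial_not_colourable r p m (c : 'I_N -> 'I_r) :
  secant r (initial_ideal le I) p -> m \in msupp p ->
  ~ window_colouring n pos [pred v | (0 < m v)%N] c.
Proof.
move=> pI mp [start win].
pose X0 (k : 'I_r) v : {mpoly K[N]} := if c v == k then 'X_v else 0.
pose has_edge (u : 'X_{1..N}) := exists a b,
  [/\ (0 < u a)%N, (0 < u b)%N, c a = c b & (pos a + n < pos b)%N].
pose Q (q : {mpoly K[N]}) := forall u, u \in msupp q -> has_edge u.
have Q0 : Q 0 by move=> u; rewrite msupp0.
have QD q1 q2 : Q q1 -> Q q2 -> Q (q1 + q2).
  by move=> h1 h2 u /msuppD_le; rewrite mem_cat => /orP[/h1|/h2].
have QM q1 q2 : Q q2 -> Q (q1 * q2).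
  move=> h u /msuppM_le/allpairsP[[u1 u2] /= [_ /h[a [b [ua ub cab ab]]] ->]].
  by exists a, b; rewrite !mnmDE !addn_gt0 ua ub !orbT.
have pE : p = p \mPo [tuple \sum_(k < r) X0 k v | v < N].
  rewrite -[LHS]comp_mpoly_id; apply: eq_comp_mpoly => v.
  rewrite (bigD1 (c v)) //= /X0 eqxx big1 ?addr0 // => k /negPf nk.
  by rewrite eq_sym nk.
suff Qp : Q p.
  have [a [b [ma mb cab ab]]] := Qp m mp.
  by have := win a ma; have := win b mb; rewrite cab; lia.
rewrite pE; apply: (secant_comp (Q := Q)) pI => // k f.
apply: (@ideal_gen_ind _ _ _ (fun f => Q (f \mPo [tuple X0 k v | v < N]))).
- by rewrite raddf0.
- by move=> q1 q2 h1 h2; rewrite raddfD; apply: QD.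
- by move=> q1 q2 h; rewrite rmorphM; apply: QM.
move=> _ [g [u [Ig gu ->]]].
(* A monomial with a variable not of colour [k] dies; any other one is fixed, and its edge has
   colour [k]. *)
have [w uw|uk] := pickP (fun v => (0 < u v)%N && (c v != k)).
  case/andP: uw => uw /negPf nk.
  rewrite comp_mpolyX (bigD1 w) //= tnth_mktuple /X0 nk expr0n.
  by rewrite eqn0Ngt uw mul0r.
have ck v : (0 < u v)%N -> c v = k.
  by move=> uv; have := uk v; rewrite uv /= => /negbFE/eqP.
have -> : 'X_[u] \mPo [tuple X0 k v | v < N] = 'X_[u].
  rewrite comp_mpolyX [RHS]mpolyXE_id; apply: eq_bigr => v _.
  rewrite tnth_mktuple /X0; case: (posnP (u v)) => [->|/ck ->].
    by rewrite !expr0.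
  by rewrite eqxx.
have [|a [b [ua ub ab]]] := @initial_toric_supp u; first by exists g.
move=> u'; rewrite msuppX inE => /eqP ->.
by exists a, b; split=> //; rewrite !ck.
Qed.

Lemma clique_mon_le r (m : 'X_{1..N}) (e : nat -> 'I_N) :
  (forall i, (i < r)%N -> (0 < m (e i))%N) ->
  (forall i j, (i < j < r)%N -> (pos (e i) + n < pos (e j))%N) ->
  ((\sum_(i < r) U_(e i))%MM <= m)%MM.
Proof.
move=> me gap; apply/mnm_lepP => v; rewrite mnm_sumE.
have [i0 /eqP ei0|no] := pickP (fun i : 'I_r => e i == v); last first.
  by rewrite big1 // => i _; rewrite mnm1E no.
rewrite (bigD1 i0) //= big1 => [|i ni]; first by rewrite mnm1E ei0 eqxx -ei0 me.
rewrite mnm1E -ei0; case: eqP => // ee.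
have := gap i i0; have := gap i0 i; rewrite ee !ltn_ord !andbT.
by move: ni; rewrite -val_eqE /=; case: ltngtP => // _ _; lia.
Qed.

Lemma delightful_scroll : delightful le I.
Proof.
(* The number of copies is now [r.+1], so the cliques have [r.+2] elements. *)
move=> [//|r] _ p; split.
  apply: ideal_gen_ind => [||q1 q2|_ [f [m [fI fm ->]]]].
  - exact: secant0.
  - exact: secantD.
  - exact: secantM.
  have [[e [me gap]]|[c col]] :=
    @clique_or_colouring _ n pos r.+1 [pred v | (0 < m v)%N] isT; last first.
    by case: (toric_lex_lead_not_colourable fI fm col).
  rewrite -(submK (clique_mon_le me gap)) mpolyXD; apply: secantM.
  rewrite (big_morph _ (@mpolyXD _ K) (@mpolyX0 _ K)).
  apply: (secant_prod (e := fun i : 'I_r.+2 => e i)) => // i1 i2.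
  rewrite -val_eqE neq_ltn => /orP[lt|lt]; last rewrite mulrC.
    by apply/initial_toric_edge/gap; rewrite lt ltn_ord.
  by apply/initial_toric_edge/gap; rewrite lt ltn_ord.
(* Conversely, each monomial of [p] is a multiple of a clique monomial, the leading monomial of a
   minor. *)
move=> pI; rewrite [p]mpolyE big_seq; apply: ideal_gen_sum => m mp.
rewrite -mul_mpolyC; apply: ideal_genM.
have [[e [me gap]]|[c col]] :=
  @clique_or_colouring _ n pos r.+1 [pred v | (0 < m v)%N] isT; last first.
  by case: (secant_initial_not_colourable pI mp col).
rewrite -(submK (clique_mon_le me gap)) mpolyXD; apply: ideal_genM.
rewrite -minor_mon1; apply: initial_ideal_lead (secant_minor gap) (minor_lead gap).
Qed.

End Scroll.

Theorem theorem5p9 (K : fieldType) (n : nat) (lam : 'I_n -> nat)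
    (n_gt0 : (0 < n)%N)
    (lam_gt0 : forall i : 'I_n, (0 < lam i)%N)
    (lam_eq : forall i k : 'I_n, lam i = lam k) :
  delightful (scroll_lex lam) (toric_ideal lam K).
Proof. exact: delightful_scroll. Qed.
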